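(* Let $d\in\{-1,\pm 2,3,\pm 6\}$, let $K=\mathbb{Q}_2(\sqrt d)$, and set $\pi=\sqrt d$ if $d$ is even and $\pi=-1+\sqrt d$ if $d$ is odd. Then the $\mathbb{Z}_2$-module $\log_{\mathcal{M}}(\mathfrak{m}_K)$ has the following $\mathbb{Z}_2$-basis: (1) for $d=-1$: $\{2\pi,4\}$; (2) for $d=-2$: $\{u\pi+2z,\,4\}$ for some unit $u\in\mathbb{Z}_2^{\times}$ and some $z\in\mathbb{Z}_2$; (3) for $d=2$: $\{\pi,4\}$; (4) for $d=3$: $\{2\pi,2\}$; (5) for $d=-6$: $\{\pi+2z,\,4\}$ for some $z\in\mathbb{Z}_2$; (6) for $d=6$: $\{\pi+2z,\,4\}$ for some $z\in\mathbb{Z}_2$.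
   Context: For a finite extension $K$ of $\mathbb{Q}_2$, $\mathcal{O}_K$ is its ring of integers and $\mathfrak{m}_K$ its maximal ideal. For $x\in\mathfrak{m}_K$, $\log_{\mathcal{M}}(x)=\log_2(1+x)=\sum_{n\ge 1}(-1)^{n-1}\frac{x^n}{n}\in K$ (convergent $2$-adic logarithm series), and $\log_{\mathcal{M}}(\mathfrak{m}_K)=\log_2(1+\mathfrak{m}_K)$ denotes the image of $\mathfrak{m}_K$; it is a $\mathbb{Z}_2$-submodule of $K$. *)

(* Defs.v *)
From HB Require Import structures.
From mathcomp Require Import all_boot all_order all_algebra all_field.
From mathcomp Require Import boolp classical_sets.

Set Implicit Arguments.
Unset Strict Implicit.
Unset Printing Implicit Defensive.

Import GRing.Theory.
Local Open Scope ring_scope.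

(* Level n of the inverse system is Z/2^(n+1), since 'Z_1 would denote Z/2. *)
Record Z2 := MkZ2 {
  residue :> forall n, 'Z_(2 ^ n.+1);
  coherent : forall n, (nat_of_ord (residue n.+1))%:R = residue n }.

Lemma Z2P (x y : Z2) : (forall n, x n = y n) -> x = y.
Proof.
case: x y => [x cx] [y cy] /= e.
have exy : x = y by apply: functional_extensionality_dep.
by case: y / exy cy e => cy _; congr MkZ2; apply: Prop_irrelevance.
Qed.

HB.instance Definition _ := gen_eqMixin Z2.
HB.instance Definition _ := gen_choiceMixin Z2.

Lemma exp2_gt1 n : (1 < 2 ^ n.+1)%N.
Proof. by rewrite -{1}(expn0 2) ltn_exp2l. Qed.

Lemma red2_nat n m k : (m <= n)%N ->
  (nat_of_ord (k%:R : 'Z_(2 ^ n.+1)))%:R = k%:R :> 'Z_(2 ^ m.+1).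
Proof.
move=> mn; apply: val_inj => /=; rewrite !val_Zp_nat ?exp2_gt1 //.
by rewrite modn_dvdm // dvdn_exp2l.
Qed.

Fact Z2_zero_coherent n : (nat_of_ord (0%R : 'Z_(2 ^ n.+2)))%:R = 0 :> 'Z_(2 ^ n.+1).
Proof. by []. Qed.
Definition Z2_zero := MkZ2 Z2_zero_coherent.

Fact Z2_one_coherent n : (nat_of_ord (1%R : 'Z_(2 ^ n.+2)))%:R = 1 :> 'Z_(2 ^ n.+1).
Proof. by []. Qed.
Definition Z2_one := MkZ2 Z2_one_coherent.

Fact Z2_add_coherent (x y : Z2) n :
  (nat_of_ord (x n.+1 + y n.+1)%R)%:R = x n + y n.
Proof.
rewrite -(coherent x n) -(coherent y n) -natrD.
by rewrite -{1}(natr_Zp (x n.+1)) -{1}(natr_Zp (y n.+1)) -natrD red2_nat.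
Qed.
Definition Z2_add x y := MkZ2 (Z2_add_coherent x y).

Fact Z2_opp_coherent (x : Z2) n :
  (nat_of_ord (- x n.+1)%R)%:R = - x n.
Proof.
apply/eqP; rewrite -addr_eq0 -(coherent x n) -natrD.
rewrite -(red2_nat (n := n.+1)) // natrD !natr_Zp addNr.
by [].
Qed.
Definition Z2_opp x := MkZ2 (Z2_opp_coherent x).

Fact Z2_mul_coherent (x y : Z2) n :
  (nat_of_ord (x n.+1 * y n.+1)%R)%:R = x n * y n.
Proof.
rewrite -(coherent x n) -(coherent y n) -natrM.
by rewrite -{1}(natr_Zp (x n.+1)) -{1}(natr_Zp (y n.+1)) -natrM red2_nat.
Qed.
Definition Z2_mul x y := MkZ2 (Z2_mul_coherent x y).

Fact Z2_addA : associative Z2_add.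
Proof. by move=> x y z; apply: Z2P => n; apply: addrA. Qed.
Fact Z2_addC : commutative Z2_add.
Proof. by move=> x y; apply: Z2P => n; apply: addrC. Qed.
Fact Z2_add0 : left_id Z2_zero Z2_add.
Proof. by move=> x; apply: Z2P => n; apply: add0r. Qed.
Fact Z2_addN : left_inverse Z2_zero Z2_opp Z2_add.
Proof. by move=> x; apply: Z2P => n; apply: addNr. Qed.
HB.instance Definition _ :=
  GRing.isZmodule.Build Z2 Z2_addA Z2_addC Z2_add0 Z2_addN.

Fact Z2_mulA : associative Z2_mul.
Proof. by move=> x y z; apply: Z2P => n; apply: mulrA. Qed.
Fact Z2_mulC : commutative Z2_mul.
Proof. by move=> x y; apply: Z2P => n; apply: mulrC. Qed.
Fact Z2_mul1 : left_id Z2_one Z2_mul.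
Proof. by move=> x; apply: Z2P => n; apply: mul1r. Qed.
Fact Z2_mulDl : left_distributive Z2_mul Z2_add.
Proof. by move=> x y z; apply: Z2P => n; apply: mulrDl. Qed.
Fact Z2_one_neq0 : Z2_one != 0.
Proof. by apply/eqP => /(congr1 (fun x : Z2 => x 0%N)) /eqP; rewrite oner_eq0. Qed.
HB.instance Definition _ :=
  GRing.Zmodule_isComNzRing.Build Z2
    Z2_mulA Z2_mulC Z2_mul1 Z2_mulDl Z2_one_neq0.

Definition Z2_unit : {pred Z2} := fun x => `[< exists y : Z2, y * x = 1 >].
Definition Z2_inv (x : Z2) : Z2 := xget x [set y | y * x = 1]%classic.
Fact Z2_mulV : {in Z2_unit, left_inverse 1 Z2_inv *%R}.
Proof. by move=> x /asboolP ux; rewrite /Z2_inv; case: xgetP => // /forallNP. Qed.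
Fact Z2_unitPl (x y : Z2) : y * x = 1 -> Z2_unit x.
Proof. by move=> yx; apply/asboolP; exists y. Qed.
Fact Z2_inv_out : {in [predC Z2_unit], Z2_inv =1 id}.
Proof.
move=> x /asboolPn ux; rewrite /Z2_inv; case: xgetP => // y _ yx.
by case: ux; exists y.
Qed.
HB.instance Definition _ :=
  GRing.ComNzRing_hasMulInverse.Build Z2 Z2_mulV Z2_unitPl Z2_inv_out.

Lemma Z2_red (x : Z2) m n : (m <= n)%N -> (nat_of_ord (x n))%:R = x m.
Proof.
move=> /subnKC <-; elim: (n - m)%N => [|k IHk]; first by rewrite addn0 natr_Zp.
rewrite -IHk -(coherent x (m + k)) addnS red2_nat //; exact: leq_addr.
Qed.

Lemma Z2_digit_eq0 (x : Z2) m n : (m <= n)%N ->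
  (x m == 0) = (2 ^ m.+1 %| x n)%N.
Proof.
move=> mn; rewrite -(Z2_red x mn) -val_eqE /= val_Zp_nat ?exp2_gt1 //.
Qed.

Fact Z2_idomain (x y : Z2) : x * y = 0 -> (x == 0) || (y == 0).
Proof.
have neq0 (z : Z2) : z != 0 -> exists m, z m != 0 :> 'Z_(2 ^ m.+1).
  move=> /eqP z0; apply: contrapT => /forallNP h; apply: z0; apply: Z2P => n.
  by apply/eqP/negPn/negP/h.
move=> xy0; apply/norP => -[/neq0[m xm] /neq0[n yn]].
pose N := (m + n).+1.
have mN : (m <= N)%N by rewrite /N -addnS leq_addr.
have nN : (n <= N)%N by rewrite /N -addSn leq_addl.
move: xm yn; rewrite (Z2_digit_eq0 x mN) (Z2_digit_eq0 y nN).
have /eqP : (x * y) N = 0 by rewrite xy0.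
rewrite (Z2_digit_eq0 _ (leqnn N)) /=.
set a := x N; set b := y N => dab an bn.
have a0 : (0 < a)%N by case: (nat_of_ord a) an => //; rewrite dvdn0.
have b0 : (0 < b)%N by case: (nat_of_ord b) bn => //; rewrite dvdn0.
have {dab} : (2 ^ N.+1 %| a * b)%N.
  have modE k : (k %% (Zp_trunc (2 ^ N.+1)).+2 = k %% 2 ^ N.+1)%N.
    by rewrite Zp_cast ?exp2_gt1.
  by move: dab; rewrite modE /dvdn modn_mod.
rewrite pfactor_dvdn ?muln_gt0 ?a0 // lognM // leqNgt => /negP; apply.
move: an bn; rewrite !pfactor_dvdn // -!ltnNge => am bn.
have {am bn} : (logn 2 a + logn 2 b <= m + n)%N by apply: leq_add.
by move=> h; apply: leq_ltn_trans h _; rewrite /N ltnS leqnSn.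
Qed.
HB.instance Definition _ := GRing.ComUnitRing_isIntegral.Build Z2 Z2_idomain.

Definition Q2 : fieldType := {fraction Z2}.

Section Extension.
Variable K : fieldExtType Q2.
Local Open Scope classical_set_scope.

Definition Z2_to (a : Z2) : K := (FracField.tofrac a)%:A.

Definition ringOfIntegers : set K := [set x | integralOver Z2_to x].

Definition isIdeal (I : set K) : Prop :=
  [/\ I `<=` ringOfIntegers, I 0,
      forall x y, I x -> I y -> I (x + y)
    & forall a x, ringOfIntegers a -> I x -> I (a * x)].

Definition isMaximalIdeal (m : set K) : Prop :=
  [/\ isIdeal m, ~ m 1
    & forall J, isIdeal J -> ~ J 1 -> m `<=` J -> J = m].

(* Convergence for the topology of K extending the 2-adic one of Q2: the sets
   2^N * ringOfIntegers form a basis of neighbourhoods of 0, since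
   ringOfIntegers is the closed unit ball of the extended absolute value. *)
Definition cvg2 (u : nat -> K) (l : K) : Prop :=
  forall N, exists n0, forall n, (n0 <= n)%N ->
    exists2 w, ringOfIntegers w & u n - l = 2 ^+ N * w.

Definition logM_partial (x : K) (n : nat) : K :=
  \sum_(1 <= k < n.+1) (-1) ^+ k.-1 * x ^+ k / k%:R.

(* xget selects the sum of the series, which is unique; it would return the
   junk value 0 on a divergent series, which does not occur when x lies in the
   maximal ideal. *)
Definition logM (x : K) : K := xget 0 [set y | cvg2 (logM_partial x) y].

Definition is_Z2_basis n (e : n.-tuple K) (M : set K) : Prop :=
  M = [set x | exists a : 'I_n -> Z2, x = \sum_i Z2_to (a i) * tnth e i] /\
  forall a : 'I_n -> Z2,
    \sum_i Z2_to (a i) * tnth e i = 0 -> forall i, a i = 0.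

End Extension.

Arguments Z2_to {K} a.

(* Main.v *)
Require Import Defs.
From HB Require Import structures.
From mathcomp Require Import all_boot all_order all_algebra all_field.
From mathcomp Require Import boolp classical_sets.
From mathcomp Require Import zify ring.

(** In each of the six cases [K] is totally ramified: [pi] is a root of an
Eisenstein polynomial [pi ^+ 2 = 2 * (s + t * pi)] with [s] an odd 2-adic
integer.  All the arithmetic of [K] follows from this one relation.  An element
[a + b * pi] with [a] odd is invertible because its norm is odd; hence every
nonzero element of [K] is a power of [pi] times a unit, the ring of integers is
[Z2 + Z2 * pi], and its only maximal ideal consists of the multiples of [pi].
Below, [pi_adic k] is the ideal generated by [pi ^+ k]; since 2 is [pi ^+ 2]
times a unit, [2 ^+ n] generates [pi_adic (2 * n)].

The logarithm is handled through the formula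
[log u = lim (u ^+ (2 ^ n) - 1) / 2 ^+ n].  The binomial theorem turns the
[n]-th term into a series whose coefficients tend to those of the logarithm
series ([logM_powlog]), while the formula itself makes it immediate that the
logarithm is additive on products ([logM_mul]), vanishes on roots of unity of
2-power order, hence at -1 ([logM_torsion]), and satisfies
[log (1 + x) = x + x ^+ 2 / 2] modulo [pi ^+ (2 * k)] when [pi ^+ k] divides
[x] and [k >= 3] ([logM_approx2]).  Consequently [log] maps [1 + pi_adic 3]
onto [pi_adic 3], by successive approximation ([logM_surj]).

Up to sign, and up to a factor in [1 + pi_adic 3], every element of
[1 + pi_adic 1] is 1 or [1 + pi].  As the logarithm ignores the sign, its image
is the union of [pi_adic 3] and of its translate by [log (1 + pi)]
([logM_image]).  Now [pi_adic 3] has basis [2 * pi], 4, and it only remains to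
locate [log (1 + pi)] modulo [pi_adic 3]:
- for [d = -1] it is 0, because [1 + pi] is a fourth root of unity;
- otherwise [(1 + pi) ^+ 2] is minus an element of [1 + pi_adic 2], whose
  logarithm is known to sufficient precision, and which is twice
  [log (1 + pi)]. This gives 2 for [d = 3], [pi] for [d = 2], and [pi] modulo 2
  for all even [d]. *)

Set Implicit Arguments.
Unset Strict Implicit.
Unset Printing Implicit Defensive.

Import GRing.Theory.
Local Open Scope ring_scope.

(** * Arithmetic of the 2-adic integers *)

Lemma Z2_natE (k n : nat) : (k%:R : Z2) n = k%:R.
Proof. by elim: k => // k IHk; rewrite -!natr1 -IHk. Qed.

(** The quotient is obtained by shifting digits: its residue modulo [2 ^ n.+1]
is the quotient by [2 ^ m.+1] of the residue of [x] modulo [2 ^ (n + m).+2]. *)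
Lemma Z2_digit0_dvd (x : Z2) m : x m = 0 -> exists y, x = 2 ^+ m.+1 * y.
Proof.
move=> xm0.
pose X n : nat := x (n + m.+1)%N.
have dX n : (2 ^ m.+1 %| X n)%N.
  rewrite -Z2_digit_eq0; first by rewrite xm0.
  by rewrite -addSnnS leq_addl.
have redX n : X n = (X n.+1 %% 2 ^ (n + m.+1).+1)%N.
  by rewrite /X -(coherent x (n + m.+1)) val_Zp_nat ?exp2_gt1.
have cy n : (nat_of_ord ((X n.+1 %/ 2 ^ m.+1)%:R : 'Z_(2 ^ n.+2)))%:R
            = (X n %/ 2 ^ m.+1)%:R :> 'Z_(2 ^ n.+1).
  rewrite red2_nat // (redX n).
  apply: val_inj; rewrite /= !val_Zp_nat ?exp2_gt1 //.
  rewrite -addSn [in RHS]expnD.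
  have /dvdnP[q ->] := dX n.+1.
  by rewrite -muln_modl !mulnK ?expn_gt0 // modn_mod.
exists (MkZ2 cy); apply: Z2P => n.
have -> : (2 ^+ m.+1 * MkZ2 cy) n = 2 ^+ m.+1 * (X n %/ 2 ^ m.+1)%:R :> 'Z_(2 ^ n.+1).
  have -> : (2 ^+ m.+1 : Z2) = (2 ^ m.+1)%:R by rewrite natrX.
  by rewrite -natrX -(Z2_natE _ n).
rewrite -natrX -natrM mulnC divnK // /X.
by rewrite Z2_red // leq_addr.
Qed.

Lemma Z2_addE (x y : Z2) n : (x + y) n = x n + y n.
Proof. by []. Qed.

Lemma Z2_exp2_digit0 n (y : Z2) : (2 ^+ n.+1 * y) n = 0.
Proof.
rewrite -natrX.
have -> : ((2 ^ n.+1)%:R * y) n = (2 ^ n.+1)%:R * y n by rewrite -(Z2_natE _ n).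
rewrite (_ : (2 ^ n.+1)%:R = 0) ?mul0r //.
by apply: val_inj; rewrite /= val_Zp_nat ?exp2_gt1 // modnn.
Qed.

Lemma Z2_separated (x : Z2) : (forall n, exists y, x = 2 ^+ n * y) -> x = 0.
Proof.
by move=> dx; apply: Z2P => n; have [y ->] := dx n.+1; rewrite Z2_exp2_digit0.
Qed.

(** Completeness, in the only form needed later: the residue of the sum modulo
[2 ^ n.+1] is already that of the first [n.+1] terms. *)
Lemma Z2_series (c : nat -> Z2) :
  exists l, forall n, exists y, l - \sum_(k < n) 2 ^+ k * c k = 2 ^+ n * y.
Proof.
pose S n := \sum_(k < n) 2 ^+ k * c k.
have SS n : S n.+1 n = S n.+2 n.
  rewrite /S [in RHS]big_ord_recr.
  by rewrite Z2_addE Z2_exp2_digit0 addr0.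
have cS n : (nat_of_ord (S n.+2 n.+1))%:R = S n.+1 n.
  by rewrite coherent -SS.
exists (MkZ2 cS) => -[|n].
  by exists (MkZ2 cS); rewrite big_ord0 subr0 expr0 mul1r.
apply: Z2_digit0_dvd.
by rewrite Z2_addE /= subrr.
Qed.

Lemma Z2_parity (x : Z2) : (exists y, x = 2 * y) \/ (exists y, x = 1 + 2 * y).
Proof.
have [x0|x0] := eqVneq (x 0%N) 0; first by left; have [y] := Z2_digit0_dvd x0; exists y.
right; have : (x - 1) 0%N = 0.
  rewrite Z2_addE.
  by apply/eqP; case: (x 0%N) x0 => -[|[|]].
by move=> /Z2_digit0_dvd[y dy]; exists y; rewrite -[x](subrK 1) dy addrC.
Qed.

(** The inverse of [1 + 2 * y] is the sum of the geometric series in [- 2 * y]. *)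
Lemma Z2_odd_unit (y : Z2) : 1 + 2 * y \is a GRing.unit.
Proof.
have [l dl] := Z2_series (fun k => (- y) ^+ k).
apply/unitrP; exists l; rewrite [_ * l]mulrC; split; apply/eqP;
  rewrite -subr_eq0; apply/eqP/Z2_separated => n;
  have [z dz] := dl n; exists ((1 + 2 * y) * z - (- y) ^+ n).
all: rewrite -[l](subrK (\sum_(k < n) 2 ^+ k * (- y) ^+ k)) dz.
all: under eq_bigr do rewrite -exprMn.
all: have := subrX1 (2 * - y) n; rewrite exprMn => e.
all: set s := \sum_(_ < _) _ in e *.
all: have {}e : 2 ^+ n * (- y) ^+ n = 1 + (2 * - y - 1) * s by rewrite -e; ring.
all: rewrite [RHS]mulrBr e.
all: by ring.
Qed.

Lemma Z2_unit_oddP (x : Z2) : reflect (exists y, x = 1 + 2 * y) (x \is a GRing.unit).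
Proof.
apply: (iffP idP) => [ux|[y ->]]; last exact: Z2_odd_unit.
have [[y dx]|//] := Z2_parity x.
have /eqP : (1 : Z2) 0%N = 0.
  by rewrite -(divrr ux) dx -mulrA -[2]expr1 Z2_exp2_digit0.
by rewrite oner_eq0.
Qed.

Lemma Z2_factor (x : Z2) : x != 0 -> exists n u, u \is a GRing.unit /\ x = 2 ^+ n * u.
Proof.
move=> x0.
have : exists n, x n != 0.
  apply: contrapT => /forallNP h; case/eqP: x0; apply: Z2P => n.
  by apply/eqP/negPn/negP/h.
case/ex_minnP=> n xn0 minn; exists n.
have [y dx] : exists y, x = 2 ^+ n * y.
  case: n xn0 minn => [_ _|n _ minn]; first by exists x; rewrite mul1r.
  by apply: Z2_digit0_dvd; apply/eqP; apply: contraT => /minn; rewrite ltnn.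
exists y; split=> //; apply/Z2_unit_oddP.
have [[z dy]|//] := Z2_parity y.
by move: xn0; rewrite dx dy mulrA -exprSr Z2_exp2_digit0 eqxx.
Qed.

Lemma Z2_nat_neq0 k : k.+1%:R != 0 :> Z2.
Proof.
apply/eqP => /(congr1 (fun x : Z2 => x k)); rewrite Z2_natE.
move=> /(congr1 val); rewrite /= val_Zp_nat ?exp2_gt1 // modn_small //.
exact: ltn_expl.
Qed.

(** * Embedding of the 2-adic integers in K *)

Section Z2InK.
Variable K : fieldExtType Q2.

Fact Z2_to_is_zmod_morphism : zmod_morphism (@Z2_to K).
Proof. by move=> a b; rewrite /Z2_to rmorphB scalerBl. Qed.

Fact Z2_to_is_monoid_morphism : monoid_morphism (@Z2_to K).
Proof.
split=> [|a b]; first by rewrite /Z2_to rmorph1 scale1r.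
by rewrite /Z2_to rmorphM -scalerAl mul1r scalerA.
Qed.

HB.instance Definition _ :=
  GRing.isZmodMorphism.Build Z2 K (@Z2_to K) Z2_to_is_zmod_morphism.
HB.instance Definition _ :=
  GRing.isMonoidMorphism.Build Z2 K (@Z2_to K) Z2_to_is_monoid_morphism.

Lemma Z2_to_eq0 (a : Z2) : (Z2_to a == 0 :> K) = (a == 0).
Proof. by rewrite /Z2_to scaler_eq0 oner_eq0 orbF tofrac_eq0. Qed.

Lemma Z2_to_unitV (a : Z2) : a \is a GRing.unit -> Z2_to a^-1 = (Z2_to a)^-1 :> K.
Proof.
move=> ua; have a0 : Z2_to a != 0 :> K.
  by rewrite Z2_to_eq0; apply: contraTneq ua => ->; rewrite unitr0.
by apply: (mulfI a0); rewrite divff // -rmorphM divrr // rmorph1.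
Qed.

Lemma two_neq0 : 2 != 0 :> K.
Proof. by rewrite -(rmorph_nat (@Z2_to K)) Z2_to_eq0 (Z2_nat_neq0 1). Qed.

(** A denominator is a power of 2 times a unit, and the unit can be moved to
the numerator. *)
Lemma Q2_eq_frac (A : Q2) : exists n (a : Z2), A%:A = Z2_to a / 2 ^+ n :> K.
Proof.
have [a [b [b0 dA]]] : exists a b : Z2,
    b != 0 /\ A = FracField.tofrac a / FracField.tofrac b.
  elim/quotW: A => x; exists (frac x).1, (frac x).2.
  have x20 := denom_ratioP x; split=> //.
  apply: (canRL (mulfK _)); first by rewrite tofrac_eq0.
  unlock FracField.tofrac; rewrite -[LHS]FracField.pi_mul.
  apply/eqmodP; rewrite /= FracField.equivfE /FracField.mulf /=.
  by rewrite !numden_Ratio ?mulf_neq0 ?oner_neq0 // !mulr1 mulrC.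
have [n [u [uu db]]] := Z2_factor b0.
exists n, (a / u).
have b0' : FracField.tofrac b != 0 by rewrite tofrac_eq0.
apply: (canRL (mulfK (expf_neq0 n two_neq0))).
rewrite -[2](rmorph_nat (@Z2_to K)) -rmorphXn /=.
rewrite /Z2_to -scalerAl mul1r scalerA; congr (_ *: _).
apply: (mulIf b0'); rewrite dA mulrAC divfK // -!rmorphM; congr (FracField.tofrac _).
by rewrite db mulrCA divrK // mulrC.
Qed.

End Z2InK.

(** * Ring structure of the integers of K *)

Section RingOfIntegers.
Variable K : fieldExtType Q2.
Implicit Types x y : K.
Local Notation O := (@ringOfIntegers K).

Lemma int_Z2 (a : Z2) : O (Z2_to a).
Proof. exact: (integral_id (@Z2_to K)). Qed.

Lemma int_nat n : O n%:R.
Proof. exact: (integral_nat (@Z2_to K)). Qed.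

Lemma int0 : O 0. Proof. exact: int_nat 0%N. Qed.
Lemma int1 : O 1. Proof. exact: int_nat 1%N. Qed.

Lemma intD x y : O x -> O y -> O (x + y).
Proof. exact: (@integral_add _ _ (@Z2_to K)). Qed.

Lemma intN x : O x -> O (- x).
Proof. exact: (@integral_opp _ _ (@Z2_to K)). Qed.

Lemma intB x y : O x -> O y -> O (x - y).
Proof. exact: (@integral_sub _ _ (@Z2_to K)). Qed.

Lemma intM x y : O x -> O y -> O (x * y).
Proof. exact: (@integral_mul _ _ (@Z2_to K)). Qed.

Lemma intX x n : O x -> O (x ^+ n).
Proof.
by move=> Ox; elim: n => [|n IH]; rewrite ?exprS; [apply: int1 | apply: intM].
Qed.

End RingOfIntegers.

(** * Lattice spanned by 1 and an Eisenstein root *)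

Section Eisenstein.
Variables (K : fieldExtType Q2) (pi : K) (s t : Z2).
Hypothesis s_unit : s \is a GRing.unit.
Hypothesis pi2 : pi ^+ 2 = 2 * (Z2_to s + Z2_to t * pi).
Hypothesis gen : forall x : K, exists A B : Q2, x = A%:A + B%:A * pi.
Implicit Types x y : K.
Local Notation O := (@ringOfIntegers K).

(** This turns out to be the ring of integers, see [int_latticeP]. *)
Definition lattice x := exists a b : Z2, x = Z2_to a + Z2_to b * pi.

Lemma lattice_Z2 a : lattice (Z2_to a).
Proof. by exists a, 0; rewrite rmorph0 mul0r addr0. Qed.

Lemma lattice0 : lattice 0.
Proof. by have := lattice_Z2 0; rewrite rmorph0. Qed.

Lemma lattice1 : lattice 1.
Proof. by have := lattice_Z2 1; rewrite rmorph1. Qed.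

Lemma lattice_pi : lattice pi.
Proof. by exists 0, 1; rewrite rmorph0 rmorph1 add0r mul1r. Qed.

Lemma latticeD x y : lattice x -> lattice y -> lattice (x + y).
Proof. by move=> [a [b ->]] [c [e ->]]; exists (a + c), (b + e); ring. Qed.

Lemma latticeN x : lattice x -> lattice (- x).
Proof. by move=> [a [b ->]]; exists (- a), (- b); ring. Qed.

Lemma latticeM x y : lattice x -> lattice y -> lattice (x * y).
Proof.
move=> [a [b ->]] [c [e ->]].
exists (a * c + 2 * s * b * e), (a * e + b * c + 2 * t * b * e).
by ring: pi2.
Qed.

Lemma latticeX x n : lattice x -> lattice (x ^+ n).
Proof.
move=> Lx; elim: n => [|n IH]; rewrite ?exprS; first exact: lattice1.
exact: latticeM.
Qed.

Lemma lattice_sum (I : Type) (r : seq I) (Q : pred I) (F : I -> K) :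
  (forall i, Q i -> lattice (F i)) -> lattice (\sum_(i <- r | Q i) F i).
Proof. by move=> LF; apply: (big_ind lattice lattice0 latticeD). Qed.

(** The units of the lattice, before it is known to be the ring of integers. *)
Definition lattice_unit x := [/\ x != 0, lattice x & lattice x^-1].

(** The norm of [a + b * pi] is congruent to [a ^+ 2] modulo 2, and the inverse
is the conjugate [a + 2 * t * b - b * pi] divided by the norm. *)
Lemma lattice_unit_odd a b : a \is a GRing.unit ->
  lattice_unit (Z2_to a + Z2_to b * pi).
Proof.
move=> /Z2_unit_oddP[a' da].
(* The norm: [X ^+ 2 - 2 * t * X - 2 * s] is the minimal polynomial of [pi]. *)
pose N := a ^+ 2 + 2 * t * a * b - 2 * s * b ^+ 2.
have uN : N \is a GRing.unit.
  apply/Z2_unit_oddP; exists (2 * a' ^+ 2 + 2 * a' + t * a * b - s * b ^+ 2).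
  by rewrite /N [in a ^+ 2]da; ring.
pose y := Z2_to (a + 2 * t * b) - Z2_to b * pi.
have xy : (Z2_to a + Z2_to b * pi) * y = Z2_to N by rewrite /y /N; ring: pi2.
have N0 : Z2_to N != 0 :> K.
  by rewrite Z2_to_eq0; apply: contraTneq uN => ->; rewrite unitr0.
have x0 : Z2_to a + Z2_to b * pi != 0.
  by apply: contra N0 => /eqP x0; rewrite -xy x0 mul0r.
split=> //; first by exists a, b.
have -> : (Z2_to a + Z2_to b * pi)^-1 = y * Z2_to N^-1.
  apply: (mulfI x0); rewrite divff // mulrA xy Z2_to_unitV //.
  by rewrite divff.
apply: latticeM; last exact: lattice_Z2.
by exists (a + 2 * t * b), (- b); rewrite /y; ring.
Qed.

(** The unit [pi ^+ 2 / 2]. *)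
Definition eps := Z2_to s + Z2_to t * pi.

Lemma eps_unit : lattice_unit eps.
Proof. exact: lattice_unit_odd. Qed.

Lemma two_pi2 : 2 = pi ^+ 2 * eps^-1.
Proof. by have [e0 _ _] := eps_unit; rewrite pi2 -/eps mulfK. Qed.

Lemma pi_neq0 : pi != 0.
Proof.
by apply: contraNneq (two_neq0 K) => p0; rewrite two_pi2 p0 expr0n mul0r.
Qed.

Lemma lattice_unitM x y : lattice_unit x -> lattice_unit y -> lattice_unit (x * y).
Proof.
by move=> [? ? ?] [? ? ?]; split; rewrite ?mulf_neq0 ?invfM //; apply: latticeM.
Qed.

Lemma lattice_unitV x : lattice_unit x -> lattice_unit x^-1.
Proof. by move=> [? ? ?]; split; rewrite ?invr_eq0 ?invrK. Qed.

Lemma lattice_unitX x n : lattice_unit x -> lattice_unit (x ^+ n).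
Proof.
move=> ux; elim: n => [|n IH]; rewrite ?exprS; last exact: lattice_unitM.
by split; rewrite ?invr1 ?oner_eq0 //; apply: lattice1.
Qed.

(** After extracting the largest common power of 2 from [a] and [b], either [a]
is odd and the element is a unit, or [b] alone is odd and the element is [pi]
times a unit. *)
Lemma lattice_factor x : lattice x -> x != 0 ->
  exists i u, lattice_unit u /\ x = pi ^+ i * u.
Proof.
move=> [a [b dx]] x0.
suff [n [i [u [uu dx']]]] : exists n i u, lattice_unit u /\ x = 2 ^+ n * (pi ^+ i * u).
  exists (2 * n + i)%N, (eps^-1 ^+ n * u); split.
    by apply/lattice_unitM => //; apply/lattice_unitX/lattice_unitV/eps_unit.
  by rewrite dx' two_pi2 exprMn -exprM exprD mulrACA mulrA.
have odd_b n c (u : Z2) : u \is a GRing.unit -> x = 2 ^+ n * (2 * Z2_to c + Z2_to u * pi) ->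
    exists n i u, lattice_unit u /\ x = 2 ^+ n * (pi ^+ i * u).
  move=> uu dx'; have [eps0 _ _] := eps_unit.
  exists n, 1%N, ((Z2_to (u * s) + Z2_to (c + u * t) * pi) / eps); split.
    apply: lattice_unitM; last exact/lattice_unitV/eps_unit.
    by apply: lattice_unit_odd; rewrite unitrM uu.
  rewrite dx'; congr (_ * _); apply: (mulIf eps0); rewrite expr1 mulrA divfK //.
  by rewrite /eps; ring: pi2.
have [b0|/Z2_factor[m [v [uv db]]]] := eqVneq b 0.
  have [n [u [uu da]]] : exists n u, u \is a GRing.unit /\ a = 2 ^+ n * u.
    apply: Z2_factor; apply: contraNneq x0 => a0.
    by rewrite dx a0 b0 !rmorph0 mul0r addr0.
  exists n, 0%N, (Z2_to u + Z2_to 0 * pi); split; first exact: lattice_unit_odd.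
  by rewrite dx b0 da rmorphM rmorphXn rmorph_nat; ring.
have [a0|/Z2_factor[n [u [uu da]]]] := eqVneq a 0.
  by apply: (odd_b m 0 v uv); rewrite dx a0 db rmorphM rmorphXn rmorph_nat; ring.
have [le_nm|lt_mn] := leqP n m.
  exists n, 0%N, (Z2_to u + Z2_to (2 ^+ (m - n) * v) * pi).
  split; first exact: lattice_unit_odd.
  rewrite dx da db -{1}(subnKC le_nm) exprD !rmorphM !rmorphXn rmorph_nat /=.
  by ring.
apply: (odd_b m (2 ^+ (n - m).-1 * u) v uv).
rewrite dx da db -{1}(subnKC lt_mn) addSnnS exprD !rmorphM !rmorphXn rmorph_nat.
by rewrite -subnS exprS; ring.
Qed.

Lemma K_factor x : x != 0 -> exists i j u, lattice_unit u /\ x = pi ^+ i * u / pi ^+ j.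
Proof.
move=> x0; have [A [B dx]] := gen x.
have [n [a dA]] := Q2_eq_frac K A; have [m [b dB]] := Q2_eq_frac K B.
pose y := x * 2 ^+ (n + m).
have y0 : y != 0 by rewrite mulf_neq0 ?expf_neq0 ?two_neq0.
have Ly : lattice y.
  exists (a * 2 ^+ m), (b * 2 ^+ n); rewrite /y dx dA dB exprD.
  rewrite !rmorphM !rmorphXn rmorph_nat.
  by field; rewrite !expf_neq0 ?two_neq0.
have [i [u [uu dy]]] := lattice_factor Ly y0.
exists i, (2 * (n + m))%N, (u / (eps^-1 ^+ (n + m))); split.
  by apply/lattice_unitM/lattice_unitV/lattice_unitX/lattice_unitV/eps_unit.
rewrite mulrA -dy exprM -mulrA -invfM -exprMn [eps^-1 * _]mulrC -two_pi2.
by rewrite mulfK // expf_neq0 // two_neq0.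
Qed.

(** If [pi * x] were 1, then [1 - pi * x] would vanish, but its constant
coefficient is odd, so that it is a unit. *)
Lemma lattice_one_notin_pi x : lattice x -> pi * x != 1.
Proof.
move=> [a [b ->]].
have [+ _ _] := @lattice_unit_odd (1 + 2 * (- (s * b))) (- (a + 2 * b * t)) (Z2_odd_unit _).
apply: contraNneq => e; apply/eqP.
rewrite -[RHS](subrr 1) -[in X in _ = _ - X]e.
by ring: pi2.
Qed.

(** [pi] is a root of the Eisenstein polynomial. *)
Lemma lattice_int x : lattice x -> O x.
Proof.
have Opi : O pi.
  pose q : {poly K} := (2 * Z2_to t) *: 'X + (2 * Z2_to s)%:P.
  pose p := 'X^2 - q.
  have sz : (size q < 3)%N.
    rewrite (leq_ltn_trans (size_polyD _ _)) // gtn_max.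
    rewrite (leq_ltn_trans (size_scale_leq _ _)) ?size_polyX //.
    by rewrite (leq_ltn_trans (size_polyC_leq1 _)).
  apply: (@integral_root_monic _ _ (@Z2_to K) pi p).
  - by rewrite monicE lead_coefDl ?lead_coefXn // size_polyN size_polyXn.
  - by apply/rootP; rewrite /p /q !hornerE pi2; ring.
  - apply/integral_poly => i; rewrite /p /q coefB coefXn coefD coefZ coefX coefC.
    apply: intB; first exact: int_nat.
    apply: intD.
      by do !apply: intM; [apply: (int_nat _ 2) | apply: int_Z2 | apply: int_nat].
    by case: ifP => _; [apply: intM; [apply: (int_nat _ 2)|apply: int_Z2]| apply: int0].
by move=> [a [b ->]]; apply: intD; [|apply: intM]; do ?apply: int_Z2.
Qed.

(** If [x] lies outside of the lattice, its inverse is a multiple [pi * w] of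
[pi].  Multiplying an integral equation of degree [n] of [x] by [(pi * w) ^+ n]
then presents 1 as a multiple of [pi] in the lattice. *)
Lemma int_lattice x : O x -> lattice x.
Proof.
have [-> _|x0] := eqVneq x 0; first exact: lattice0.
have [i [j [u [[u0 Lu Lv] dx]]]] := K_factor x0.
have p0 := pi_neq0.
have [le_ji _|lt_ij] := leqP j i.
  rewrite dx -(subnK le_ji) exprD mulrAC mulfK ?expf_neq0 //.
  by apply: latticeM => //; apply/latticeX/lattice_pi.
(* [w] is chosen so that [pi * w] is the inverse of [x]. *)
pose w := pi ^+ (j - i).-1 * u^-1.
have Lw : lattice w by apply: latticeM => //; apply/latticeX/lattice_pi.
have xw : x * (pi * w) = 1.
  rewrite /w [pi * _]mulrA -exprS prednK ?subn_gt0 // dx.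
  rewrite -(subnK (ltnW lt_ij)) exprD addnK.
  by field; rewrite u0 !expf_neq0.
move=> [p mp /rootP].
pose n := (size p).-1; have szp : size p = n.+1.
  by rewrite /n prednK // size_poly_gt0 monic_neq0.
have spK : size (map_poly Z2_to p : {poly K}) = n.+1.
  by rewrite size_map_poly_id0 // (monicP mp) rmorph1 oner_eq0.
have lcK : (map_poly Z2_to p : {poly K})`_n = 1.
  by rewrite coef_map /= -[p`_n]/(lead_coef p) (monicP mp) rmorph1.
rewrite horner_coef spK big_ord_recr /= => /(congr1 ( *%R^~ ((pi * w) ^+ n))).
rewrite mul0r mulrDl lcK mul1r -exprMn xw expr1n => e.
have [v Lv' dv] : exists2 v, lattice v &
    (\sum_(k < n) (map_poly Z2_to p)`_k * x ^+ k) * (pi * w) ^+ n = pi * v.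
  exists (\sum_(k < n) Z2_to p`_k * (pi ^+ (n - k).-1 * w ^+ (n - k))).
    apply: lattice_sum => k _; apply: latticeM; first exact: lattice_Z2.
    by apply: latticeM; apply: latticeX => //; apply: lattice_pi.
  rewrite mulr_suml mulr_sumr; apply: eq_bigr => k _.
  have -> : (pi * w) ^+ n = (pi * w) ^+ (n - k) * (pi * w) ^+ k.
    by rewrite -exprD subnK // ltnW.
  have xwk : x ^+ k * (pi * w) ^+ k = 1 by rewrite -exprMn xw expr1n.
  rewrite coef_map /= -mulrA [X in _ * X]mulrCA xwk mulr1 exprMn.
  by rewrite -{1}[(n - k)%N]prednK ?subn_gt0 // exprS; ring.
have := lattice_one_notin_pi (latticeN Lv').
by rewrite mulrN -dv -subr_eq0 -opprD oppr_eq0 e eqxx.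
Qed.

Lemma int_latticeP x : O x <-> lattice x.
Proof. by split; [apply: int_lattice | apply: lattice_int]. Qed.

Lemma int_pi : O pi. Proof. exact/int_latticeP/lattice_pi. Qed.
Lemma int_eps : O eps. Proof. by apply/int_latticeP; have [] := eps_unit. Qed.
Lemma int_epsV : O eps^-1. Proof. by apply/int_latticeP; have [] := eps_unit. Qed.

(** * Filtration by the powers of the maximal ideal *)

Definition pi_adic k x := exists2 w, O w & x = pi ^+ k * w.

Lemma pi_adic_zero k : pi_adic k 0.
Proof. by exists 0; [apply: int0 | rewrite mulr0]. Qed.

Lemma pi_adic_add k x y : pi_adic k x -> pi_adic k y -> pi_adic k (x + y).
Proof. by move=> [v Ov ->] [w Ow ->]; exists (v + w); [apply: intD | ring]. Qed.

Lemma pi_adic_opp k x : pi_adic k x -> pi_adic k (- x).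
Proof. by move=> [v Ov ->]; exists (- v); [apply: intN | ring]. Qed.

Lemma pi_adic_sub k x y : pi_adic k x -> pi_adic k y -> pi_adic k (x - y).
Proof. by move=> Px Py; apply/pi_adic_add/pi_adic_opp. Qed.

Lemma pi_adic_addr k x y : pi_adic k y -> pi_adic k (x + y) -> pi_adic k x.
Proof. by move=> Py Pxy; rewrite -[x](addrK y); apply: pi_adic_sub. Qed.

Lemma pi_adic_mul i j x y : pi_adic i x -> pi_adic j y -> pi_adic (i + j) (x * y).
Proof.
by move=> [v Ov ->] [w Ow ->]; exists (v * w); [apply: intM | rewrite exprD; ring].
Qed.

Lemma pi_adic_intP x : pi_adic 0 x <-> O x.
Proof.
split=> [[w Ow ->]|Ox]; first by rewrite mul1r.
by exists x; rewrite ?mul1r.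
Qed.

Lemma pi_adic_intM k a x : O a -> pi_adic k x -> pi_adic k (a * x).
Proof. by move=> /pi_adic_intP Pa Px; rewrite -[k]add0n; apply: pi_adic_mul. Qed.

Lemma pi_adic_le i j x : (i <= j)%N -> pi_adic j x -> pi_adic i x.
Proof.
move=> ij [w Ow ->]; exists (pi ^+ (j - i) * w).
  by apply: intM => //; apply/intX/int_pi.
by rewrite mulrA -exprD subnKC.
Qed.

Lemma pi_adic_int k x : pi_adic k x -> O x.
Proof. by move=> /(pi_adic_le (leq0n k))/pi_adic_intP. Qed.

Lemma pi_adic_pi k : pi_adic k (pi ^+ k).
Proof. by exists 1; [apply: int1 | rewrite mulr1]. Qed.

Lemma pi_adic_mulpi i k x : pi_adic (i + k) (pi ^+ i * x) <-> pi_adic k x.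
Proof.
split=> [[w Ow e]|Px]; last by apply: pi_adic_mul => //; apply: pi_adic_pi.
by exists w => //; apply: (mulfI (expf_neq0 i pi_neq0)); rewrite e exprD mulrA.
Qed.

Lemma pi_adic_mul2 n k x : pi_adic (2 * n + k) (2 ^+ n * x) <-> pi_adic k x.
Proof.
have [e0 _ _] := eps_unit.
rewrite two_pi2 exprMn -exprM -mulrA pi_adic_mulpi; split; last first.
  by apply: pi_adic_intM; apply/intX/int_epsV.
have /pi_adic_intM H : O (eps ^+ n) by apply/intX/int_eps.
by move/H; rewrite mulrA -exprMn mulfV // expr1n mul1r.
Qed.

Lemma pi_adic_two n : pi_adic (2 * n) (2 ^+ n).
Proof.
rewrite -[X in pi_adic X]addn0 -[2 ^+ n]mulr1.
exact/pi_adic_mul2/pi_adic_intP/int1.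
Qed.

Lemma pi_adic_evenP n x : pi_adic (2 * n) x <-> exists2 w, O w & x = 2 ^+ n * w.
Proof.
split=> [|[w Ow ->]]; last first.
  by rewrite -[X in pi_adic X]addn0; apply/pi_adic_mul2/pi_adic_intP.
have two0 := expf_neq0 n (two_neq0 K).
move=> Px; exists (x / 2 ^+ n); last by rewrite mulrC divfK.
by apply/pi_adic_intP/(pi_adic_mul2 n); rewrite addn0 mulrC divfK.
Qed.

(** The residue field has two elements. *)
Lemma pi_adic_residue x : O x -> pi_adic 1 x \/ pi_adic 1 (x - 1).
Proof.
move=> /int_latticeP[a [b ->]].
have Pb c : pi_adic 1 (2 * Z2_to c + Z2_to b * pi).
  apply: pi_adic_add; last first.
    by apply: pi_adic_intM; [apply: int_Z2 | apply: (pi_adic_pi 1)].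
  rewrite mulrC; apply: pi_adic_intM; first exact: int_Z2.
  exact: (pi_adic_le _ (pi_adic_two 1)).
have [[c ->]|[c ->]] := Z2_parity a; [left | right].
  by rewrite rmorphM rmorph_nat; apply: Pb.
rewrite (_ : _ - 1 = 2 * Z2_to c + Z2_to b * pi); first exact: Pb.
by ring.
Qed.

Lemma pi_adic_one_notin : ~ pi_adic 1 1.
Proof.
move=> [w /int_latticeP Lw /esym/eqP]; rewrite expr1.
exact/negP/lattice_one_notin_pi.
Qed.

(** Again an element whose constant coefficient is odd. *)
Lemma one_plus_pi_unit x : pi_adic 1 x -> 1 + x != 0 /\ O (1 + x)^-1.
Proof.
move=> [w /int_latticeP[a [b ->]] ->].
have -> : 1 + pi ^+ 1 * (Z2_to a + Z2_to b * pi) =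
    Z2_to (1 + 2 * (s * b)) + Z2_to (a + 2 * t * b) * pi by ring: pi2.
by have [? _ /int_latticeP] := lattice_unit_odd (a + 2 * t * b) (Z2_odd_unit (s * b)).
Qed.

(** An integer outside of [pi_adic 1] is a unit, so a proper ideal is contained
in [pi_adic 1], which is itself a proper ideal. *)
Lemma maximal_idealP (m : set K) : isMaximalIdeal m -> forall x, m x <-> pi_adic 1 x.
Proof.
move=> [[mO m0 mD mM] m1 maxm].
have mP x : m x -> pi_adic 1 x.
  move=> mx; have [//|Px1] := pi_adic_residue (mO _ mx).
  have [u0 Ou] := one_plus_pi_unit Px1; rewrite addrC subrK in u0 Ou.
  by case: m1; rewrite -(mulVf u0); apply: mM.
have idealP : isIdeal (pi_adic 1).
  split=> [x /pi_adic_int //||x y|a x].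
  - exact: pi_adic_zero.
  - exact: pi_adic_add.
  - exact: pi_adic_intM.
have <- : (pi_adic 1 : set K) = m by apply: maxm; [| exact: pi_adic_one_notin |].
by [].
Qed.

(** A nonzero element is a unit times a power of [pi], which bounds the ideals
that contain it. *)
Lemma pi_adic_separated x : (forall n, pi_adic (2 * n) x) -> x = 0.
Proof.
move=> Px; apply: contrapT => /eqP /K_factor[i [j [u [[u0 Lu Lv] dx]]]].
have : pi_adic (i + 1) x by apply: pi_adic_le (Px (i + 1)%N); rewrite leq_pmull.
rewrite dx -mulrA pi_adic_mulpi => Puj.
apply: pi_adic_one_notin; rewrite -(mulVf u0).
apply: pi_adic_intM; first exact/int_latticeP.
rewrite -[u](divfK (expf_neq0 j pi_neq0)) mulrC.
by apply: pi_adic_intM => //; apply/intX/int_pi.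
Qed.

(** Completeness is inherited from [Z2], one coordinate at a time. *)
Lemma K_complete (f : nat -> K) :
  (forall n, exists2 w, O w & f n.+1 - f n = 2 ^+ n * w) ->
  exists l, forall n, pi_adic (2 * n) (l - f n).
Proof.
move=> df.
have /choice[c dc] : forall n, exists c : Z2 * Z2,
    f n.+1 - f n = 2 ^+ n * (Z2_to c.1 + Z2_to c.2 * pi).
  by move=> n; have [w /int_latticeP[a [b ->]] e] := df n; exists (a, b).
have [l1 dl1] := Z2_series (fun n => (c n).1).
have [l2 dl2] := Z2_series (fun n => (c n).2).
exists (f 0%N + (Z2_to l1 + Z2_to l2 * pi)) => n; apply/pi_adic_evenP.
have [y1 dy1] := dl1 n; have [y2 dy2] := dl2 n.
exists (Z2_to y1 + Z2_to y2 * pi).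
  by apply/int_latticeP; exists y1, y2.
have -> : f n = f 0%N + (Z2_to (\sum_(k < n) 2 ^+ k * (c k).1)
                         + Z2_to (\sum_(k < n) 2 ^+ k * (c k).2) * pi).
  elim: (n) => [|k IH]; first by rewrite !big_ord0 rmorph0; ring.
  rewrite !big_ord_recr /= !(rmorphD, rmorphM, rmorphXn, rmorph_nat) /=.
  by rewrite -[f k.+1](subrK (f k)) dc IH; ring.
have -> : 2 ^+ n = Z2_to (2 ^+ n) :> K by rewrite rmorphXn rmorph_nat.
rewrite mulrDr mulrA -!rmorphM -dy1 -dy2.
by ring.
Qed.

(** * The logarithm as a limit of powers *)

Lemma cvg2P (f : nat -> K) l :
  cvg2 f l <-> forall N, exists n0, forall n, (n0 <= n)%N -> pi_adic (2 * N) (f n - l).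
Proof.
by split=> h N; have [n0 hn0] := h N; exists n0 => n /hn0 /pi_adic_evenP.
Qed.

Lemma cvg2_unique (f : nat -> K) l l' : cvg2 f l -> cvg2 f l' -> l = l'.
Proof.
move=> /cvg2P fl /cvg2P fl'; apply/eqP; rewrite -subr_eq0; apply/eqP/pi_adic_separated => N.
have [n1 h1] := fl N; have [n2 h2] := fl' N.
rewrite (_ : l - l' = (f (maxn n1 n2) - l') - (f (maxn n1 n2) - l)); last by ring.
by apply: pi_adic_sub; [apply/h2/leq_maxr | apply/h1/leq_maxl].
Qed.

(** The approximations of [log u]: heuristically [u ^+ (2 ^ n)] is
[exp (2 ^+ n * log u)], which is [1 + 2 ^+ n * log u] up to terms of order
[2 ^+ (2 * n)]. *)
Definition powlog n u : K := (u ^+ (2 ^ n) - 1) / 2 ^+ n.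

Lemma powlogK n u : u ^+ (2 ^ n) = 1 + 2 ^+ n * powlog n u.
Proof.
by rewrite /powlog mulrC divfK ?expf_neq0 ?two_neq0 // addrC subrK.
Qed.

Lemma powlog1 x : powlog 1 (1 + x) = x + x ^+ 2 / 2.
Proof. by rewrite /powlog; field; apply: two_neq0. Qed.

(** Squaring [1 + 2 ^+ n.+1 * powlog n.+1 u].  From this recursion the
approximations form a Cauchy sequence as soon as [powlog 1 u] is integral. *)
Lemma powlogS n u : powlog n.+2 u = powlog n.+1 u + 2 ^+ n * powlog n.+1 u ^+ 2.
Proof.
rewrite {1}/powlog expnSr exprM powlogK.
by rewrite !exprS; field; rewrite expf_neq0 ?two_neq0.
Qed.

(** Up to an error divisible by [2 ^+ n], the approximations are additive; in
the limit so is the logarithm. *)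
Lemma powlogM n u v :
  powlog n (u * v) = powlog n u + powlog n v + 2 ^+ n * (powlog n u * powlog n v).
Proof.
rewrite {1}/powlog exprMn !powlogK.
by field; rewrite expf_neq0 ?two_neq0.
Qed.

(** By [powlogS], all later corrections are multiples of squares of elements of
[pi_adic k]. *)
Lemma powlog_sub k u : pi_adic k (powlog 1 u) -> 
  forall n, pi_adic (2 * k) (powlog n.+1 u - powlog 1 u) /\ pi_adic k (powlog n.+1 u).
Proof.
move=> P1 n.
suff H : pi_adic (2 * k) (powlog n.+1 u - powlog 1 u).
  by split=> //; rewrite -[powlog n.+1 u](subrK (powlog 1 u)); apply: pi_adic_add => //;
    apply: pi_adic_le H; rewrite mul2n -addnn leq_addl.
elim: n => [|n IH]; first by rewrite subrr; apply: pi_adic_zero.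
rewrite powlogS addrAC; apply: pi_adic_add => //.
apply: pi_adic_intM; first by apply: intX; apply: (int_nat _ 2).
rewrite expr2 mul2n -addnn; apply: pi_adic_mul.
all: rewrite -[powlog n.+1 u](subrK (powlog 1 u)); apply: pi_adic_add => //.
all: by apply: pi_adic_le IH; rewrite mul2n -addnn leq_addl.
Qed.

Lemma powlog1_int x : pi_adic 1 x -> O (powlog 1 (1 + x)).
Proof.
move=> Px; rewrite powlog1; apply: intD; first exact: pi_adic_int Px.
apply/pi_adic_intP/(pi_adic_mul2 1).
by rewrite expr1 [2 * _]mulrC divfK ?two_neq0 // expr2; apply: (pi_adic_mul Px Px).
Qed.

Lemma powlog_cvg x : pi_adic 1 x -> exists l, cvg2 (powlog^~ (1 + x)) l.
Proof.
move=> Px.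
have Oa n : O (powlog n.+1 (1 + x)).
  by apply/pi_adic_intP; apply: (powlog_sub _ n).2; apply/pi_adic_intP/powlog1_int.
have [n|l hl] := @K_complete (fun n => powlog n.+1 (1 + x)).
  by exists (powlog n.+1 (1 + x) ^+ 2); [apply: intX | rewrite powlogS addrAC subrr add0r].
exists l; apply/cvg2P => N; exists N.+1 => -[//|n] nN.
rewrite -opprB; apply: pi_adic_opp; apply: pi_adic_le (hl n).
by rewrite leq_mul2l.
Qed.

Lemma powlog_lim_approx k u l : pi_adic k (powlog 1 u) -> cvg2 (powlog^~ u) l ->
  pi_adic (2 * k) (l - powlog 1 u).
Proof.
move=> P1 /cvg2P /(_ k)[n0 /(_ n0.+1 (leqnSn _)) h].
have [h' _] := powlog_sub P1 n0.
rewrite (_ : l - _ = (powlog n0.+1 u - powlog 1 u) - (powlog n0.+1 u - l)); last by ring.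
exact: pi_adic_sub.
Qed.

(** The odd part of [k] is a unit, and its 2-part is a divisor of [2 ^+ v]. *)
Lemma pi_adic_divn k v j y : (0 < k)%N -> (logn 2 k <= v)%N ->
  pi_adic (2 * v + j) y -> pi_adic j (y / k%:R).
Proof.
move=> k0 lev Py.
have [m cm dk] := pfactor_coprime (isT : prime 2) k0.
set e := logn 2 k in lev dk.
have [m0 Om] : m%:R != 0 :> K /\ O m%:R^-1.
  have -> : m%:R = 1 + 2 * (m./2)%:R :> K.
    rewrite -natrM addrC natr1 mul2n; congr _%:R.
    by rewrite -[m in LHS]odd_double_half -coprime2n cm.
  apply: one_plus_pi_unit; rewrite mulrC; apply: pi_adic_intM; first exact: int_nat.
  exact: (pi_adic_le _ (pi_adic_two 1)).
apply/(pi_adic_mul2 e).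
have -> : 2 ^+ e * (y / k%:R) = m%:R^-1 * y.
  by rewrite dk natrM natrX; field; rewrite m0 expf_neq0 ?two_neq0.
apply: pi_adic_intM => //; apply: pi_adic_le Py.
by rewrite leq_add2r leq_mul2l.
Qed.

Lemma logn2_le k : (logn 2 k.+1 <= k)%N.
Proof.
have := dvdn_leq (ltn0Sn k) (pfactor_dvdnn 2 k.+1).
move=> le1; rewrite -ltnS; apply: leq_trans le1.
exact: ltn_expl.
Qed.

(** The terms of the logarithm series tend to 0: dividing by [k] costs [2 * w]
factors [pi], where [w] is the exponent of 2 in [k], and [2 * w] is at most
[k / 2 + 2] because [4 * w <= 2 ^ w + 4]. *)
Lemma pi_adic_log_term x N k : pi_adic 1 x -> (4 * N + 4 <= k)%N ->
  pi_adic (2 * N) (x ^+ k / k%:R).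
Proof.
move=> Px leNk.
have k0 : (0 < k)%N by apply: leq_trans leNk; rewrite addn4.
apply: (pi_adic_divn k0 (leqnn _)).
have := dvdn_leq k0 (pfactor_dvdnn 2 k).
set v := logn 2 k => lev.
have lin w : (4 * w <= 2 ^ w + 4)%N.
  elim: w => // -[|[|[|w]]] // IH.
  have : (2 ^ 3 <= 2 ^ w.+3)%N by rewrite leq_exp2l.
  by rewrite [(2 ^ w.+4)%N]expnS; lia.
apply: (@pi_adic_le _ k); first by have := lin v; lia.
have : pi_adic (1 * k) (x ^+ k).
  elim: (k) => [|j IH]; first by apply/pi_adic_intP/int1.
  by rewrite exprS mulnS; apply: pi_adic_mul.
by rewrite mul1n.
Qed.

(** By Pascal's rule, two consecutive binomial coefficients of [2 ^ n - 1] add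
up to ['C(2 ^ n, i.+1)], which equals [2 ^ n / i.+1] times an integer, hence is
highly divisible by 2.  So these coefficients alternate in sign modulo a large
power of 2.  The bound is crude: each step loses one factor 2. *)
Lemma bin_pow2_approx n i : (i <= n)%N ->
  pi_adic (2 * (n - i)) (('C((2 ^ n).-1, i))%:R - (-1) ^+ i).
Proof.
elim: i => [_|i IH lt_in]; first by rewrite bin0 expr0 subrr; apply: pi_adic_zero.
have N0 : (0 < 2 ^ n)%N by rewrite expn_gt0.
have e1 : ('C(2 ^ n, i.+1))%:R = 'C((2 ^ n).-1, i.+1)%:R + 'C((2 ^ n).-1, i)%:R :> K.
  by rewrite -natrD -binS prednK.
rewrite (_ : _ - _ =
  ('C(2 ^ n, i.+1))%:R - (('C((2 ^ n).-1, i))%:R - (-1) ^+ i)); last first.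
  by rewrite e1 exprS; ring.
apply: pi_adic_sub; last by apply: pi_adic_le (IH (ltnW lt_in)); rewrite leq_mul2l; lia.
have i0 : i.+1%:R != 0 :> K.
  by rewrite -(rmorph_nat (@Z2_to K)) Z2_to_eq0 Z2_nat_neq0.
have -> : ('C(2 ^ n, i.+1))%:R = (2 ^+ n * ('C((2 ^ n).-1, i))%:R) / i.+1%:R :> K.
  apply: (canRL (mulfK i0)); rewrite -natrX -!natrM; congr _%:R.
  by rewrite mulnC mul_bin_diag.
apply: (@pi_adic_divn i.+1 i _ _ isT (logn2_le i)).
rewrite -mulnDr mulrC; apply: pi_adic_intM; first exact: int_nat.
by apply: pi_adic_le (pi_adic_two n); rewrite leq_mul2l; lia.
Qed.

(** This is [logM_partial] with the sign [(-1) ^+ i] replaced by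
['C(2 ^ n - 1, i)]; it comes from [i.+1 * 'C(N, i.+1) = N * 'C(N - 1, i)]. *)
Lemma powlog_binomial n x : powlog n (1 + x) =
  \sum_(0 <= i < 2 ^ n) ('C((2 ^ n).-1, i))%:R * x ^+ i.+1 / i.+1%:R.
Proof.
rewrite /powlog exprDn big_ord_recl /= bin0 mulr1n expr1n mul1r expr0.
rewrite addrAC subrr add0r mulr_suml big_mkord; apply: eq_bigr => i _.
rewrite /bump /= add1n expr1n mul1r -mulr_natl.
have i0 : i.+1%:R != 0 :> K.
  by rewrite -(rmorph_nat (@Z2_to K)) Z2_to_eq0 Z2_nat_neq0.
have e : 2 ^+ n * ('C((2 ^ n).-1, i))%:R = i.+1%:R * ('C(2 ^ n, i.+1))%:R :> K.
  by rewrite -natrX -!natrM mul_bin_diag.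
have n0 := expf_neq0 n (two_neq0 K).
apply: (mulIf n0); rewrite divfK //; apply: (mulIf i0).
by rewrite [RHS]mulrAC divfK // mulrC mulrA -e; ring.
Qed.

(** * Comparison with the logarithm series *)

(** The first [M] terms of [powlog_binomial] are close to those of the series by
[bin_pow2_approx] when [n] is large compared to [M]; the other terms are small
by [pi_adic_log_term], their binomial coefficients being integers. *)
Lemma logM_partial_cvg x l : pi_adic 1 x -> cvg2 (powlog^~ (1 + x)) l ->
  cvg2 (logM_partial x) l.
Proof.
move=> Px /cvg2P cl; apply/cvg2P => N; exists (4 * N + 4)%N => M leM.
have [n0 /(_ (maxn n0 (2 * M + N)) (leq_maxl _ _))] := cl N.
set n := maxn _ _ => h.
have len : (2 * M + N <= n)%N by apply: leq_maxr.
have leMn : (M <= 2 ^ n)%N by apply: leq_trans (ltnW (ltn_expl n (isT : 1 < 2)%N)); lia.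
rewrite (_ : _ - l =
  (powlog n (1 + x) - l) - (powlog n (1 + x) - logM_partial x M)); last by ring.
apply: pi_adic_sub => //.
rewrite powlog_binomial /logM_partial big_add1 /= (big_cat_nat (leq0n M) leMn) /=.
rewrite addrAC -sumrB; apply: pi_adic_add.
  rewrite big_nat; apply: (big_ind (pi_adic (2 * N))) => [|y z|i /andP[_ iM]].
  - exact: pi_adic_zero.
  - exact: pi_adic_add.
  rewrite -!mulrBl; apply: (@pi_adic_divn i.+1 i _ _ isT (logn2_le i)).
  rewrite mulrC; apply: pi_adic_intM; first exact: intX (pi_adic_int Px).
  by apply: pi_adic_le (bin_pow2_approx _); lia.
rewrite big_nat; apply: (big_ind (pi_adic (2 * N))) => [|y z|i /andP[Mi _]].
- exact: pi_adic_zero.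
- exact: pi_adic_add.
rewrite -mulrA; apply: pi_adic_intM; first exact: int_nat.
by apply: pi_adic_log_term => //; lia.
Qed.

Lemma logM_powlog x : pi_adic 1 x -> cvg2 (powlog^~ (1 + x)) (logM x).
Proof.
move=> Px; have [l cl] := powlog_cvg Px.
have cp := logM_partial_cvg Px cl.
suff -> : logM x = l by [].
rewrite /logM; case: xgetP => [y _ cy|/(_ l) //].
exact: cvg2_unique cy cp.
Qed.

(** * Properties of the logarithm *)

Lemma logM_mul x y : pi_adic 1 x -> pi_adic 1 y ->
  logM ((1 + x) * (1 + y) - 1) = logM x + logM y.
Proof.
move=> Px Py.
have Pxy : pi_adic 1 ((1 + x) * (1 + y) - 1).
  rewrite (_ : _ - 1 = x + (1 + x) * y); last by ring.
  apply: pi_adic_add => //; apply: pi_adic_intM => //.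
  by apply: intD; [apply: int1 | apply: pi_adic_int Px].
have := logM_powlog Pxy; rewrite addrC subrK => cxy.
apply: (cvg2_unique cxy); apply/cvg2P => N.
have [n1 h1] := (cvg2P _ _).1 (logM_powlog Px) N.
have [n2 h2] := (cvg2P _ _).1 (logM_powlog Py) N.
exists (maxn N.+1 (maxn n1 n2)) => n; rewrite !geq_max => /and3P[Nn /h1 {}h1 /h2 {}h2].
rewrite powlogM (_ : _ - _ = (powlog n (1 + x) - logM x) + (powlog n (1 + y) - logM y)
  + 2 ^+ n * (powlog n (1 + x) * powlog n (1 + y))); last by ring.
apply: pi_adic_add; first exact: pi_adic_add.
have Oa z : pi_adic 1 z -> O (powlog n (1 + z)).
  move=> Pz; case: n Nn {h1 h2} => // n _.
  by apply/pi_adic_intP; apply: (powlog_sub _ n).2; apply/pi_adic_intP/powlog1_int.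
rewrite mulrC; apply: pi_adic_intM; first by apply: intM; apply: Oa.
by apply: pi_adic_le (pi_adic_two n); rewrite leq_mul2l; lia.
Qed.

Lemma logM_torsion x k : pi_adic 1 x -> (1 + x) ^+ (2 ^ k) = 1 -> logM x = 0.
Proof.
move=> Px e; apply: (cvg2_unique (logM_powlog Px)); apply/cvg2P => N.
exists k => n /subnKC <-; rewrite /powlog expnD exprM e expr1n subrr mul0r subr0.
exact: pi_adic_zero.
Qed.

Lemma logM_approx2 k x : (3 <= k)%N -> pi_adic k x ->
  pi_adic (2 * k) (logM x - (x + x ^+ 2 / 2)).
Proof.
move=> k3 Px; rewrite -powlog1.
apply: powlog_lim_approx; last by apply/logM_powlog/(pi_adic_le _ Px)/(leq_trans _ k3).
rewrite powlog1; apply: pi_adic_add => //; apply/(pi_adic_mul2 1).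
rewrite expr1 [2 * _]mulrC divfK ?two_neq0 // expr2.
by apply: pi_adic_le (pi_adic_mul Px Px); lia.
Qed.

Lemma logM_approx k x : (3 <= k)%N -> pi_adic k x -> pi_adic k.+1 (logM x - x).
Proof.
move=> k3 Px; rewrite (_ : _ - x = logM x - (x + x ^+ 2 / 2) + x ^+ 2 / 2); last by ring.
apply: pi_adic_add; first by apply: pi_adic_le (logM_approx2 k3 Px); lia.
apply/(pi_adic_mul2 1); rewrite expr1 [2 * _]mulrC divfK ?two_neq0 // expr2.
by apply: pi_adic_le (pi_adic_mul Px Px); lia.
Qed.

Lemma logM_pi_adic k x : (3 <= k)%N -> pi_adic k x -> pi_adic k (logM x).
Proof.
move=> k3 Px; rewrite -[logM x](subrK x); apply: pi_adic_add => //.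
exact: pi_adic_le (logM_approx k3 Px).
Qed.

(** The image under [log] of [1 + x] approximates [x] to one more power of
[pi].  Starting from a target [t'], multiply [1 + x] repeatedly by 1 plus the
error that is left: the error gains a factor [pi] each time, and the products
converge. *)
Lemma logM_surj t' : pi_adic 3 t' -> exists2 x, pi_adic 3 x & logM x = t'.
Proof.
move=> Pt.
(* The first component is the current [x], the second one the error
   [t' - logM x] that is left; the error after step [n] is in [pi_adic (n + 3)]. *)
pose step p : K * K := ((1 + p.1) * (1 + p.2) - 1, p.2 - logM p.2).
pose st n := iter n step (0, t').
have inv n : [/\ pi_adic 3 (st n).1, pi_adic (n + 3) (st n).2, logM (st n).1 = t' - (st n).2
               & pi_adic (n + 3) ((st n.+1).1 - (st n).1)].
  have dst m : (st m.+1).1 - (st m).1 = (1 + (st m).1) * (st m).2 by rewrite /=; ring.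
  elim: n => [|n [Px Py e Pd]].
    rewrite dst /=; split; rewrite ?addr0 ?mul1r //; first exact: pi_adic_zero.
    rewrite subrr; apply: (@logM_torsion _ 0); first exact: pi_adic_zero.
    by rewrite addr0.
  have le3 : (3 <= n + 3)%N by rewrite leq_addl.
  have Px' : pi_adic 3 (st n.+1).1.
    by rewrite -[_.1](subrK (st n).1); apply: pi_adic_add => //; apply: pi_adic_le Pd.
  have Py' : pi_adic (n.+1 + 3) (st n.+1).2.
    have -> : (st n.+1).2 = - (logM (st n).2 - (st n).2) by rewrite opprB.
    by rewrite addSn; apply: pi_adic_opp; apply: logM_approx.
  split=> //; last first.
    rewrite dst; apply: pi_adic_intM => //.
    by apply: intD; [apply: int1 | apply: pi_adic_int Px'].
  rewrite [in LHS]/= logM_mul; first by rewrite e /=; ring.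
    exact: pi_adic_le Px.
  by apply: pi_adic_le Py; rewrite addn3.
(* [K_complete] wants a gain of a factor 2 at each step, that is, [pi ^+ 2]. *)
have [n|x hx] := @K_complete (fun n => (st (2 * n)%N).1).
  apply/pi_adic_evenP; rewrite mulnS.
  rewrite (_ : _ - _ = ((st (2 + 2 * n)%N).1 - (st (2 * n).+1).1)
    + ((st (2 * n).+1).1 - (st (2 * n)%N).1)); last by ring.
  by apply: pi_adic_add; [have [_ _ _] := inv (2 * n).+1 | have [_ _ _] := inv (2 * n)%N];
     apply: pi_adic_le; rewrite ?addSn; lia.
have Px : pi_adic 3 x.
  rewrite -[x](subrK (st 4).1); apply: pi_adic_add; first exact: pi_adic_le (hx 2).
  by have [] := inv 4.
exists x => //; apply/eqP; rewrite -subr_eq0; apply/eqP/pi_adic_separated => n.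
have [Pa Pb e _] := inv (2 * n.+2)%N; have := hx n.+2.
move: Pa Pb e; set a := (st _).1; set b := (st _).2 => Pa Pb e Pxa.
have [a0 Oa] := one_plus_pi_unit (pi_adic_le (isT : 1 <= 3)%N Pa).
have Pz : pi_adic (2 * n.+2) ((x - a) / (1 + a)) by rewrite mulrC; apply: pi_adic_intM.
have -> : x = (1 + a) * (1 + (x - a) / (1 + a)) - 1 by field.
rewrite logM_mul ?e; [|exact: pi_adic_le Pa| by apply: pi_adic_le Pz; lia].
rewrite (_ : _ - t' = logM ((x - a) / (1 + a)) - b); last by ring.
apply: (@pi_adic_le _ (2 * n.+2)); first by lia.
apply: pi_adic_sub; first by apply: logM_pi_adic => //; lia.
by apply: pi_adic_le Pb; rewrite leq_addr.
Qed.

(** * Image of the maximal ideal *)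

Lemma logM_neg1 : logM (- 2 : K) = 0.
Proof.
apply: (@logM_torsion _ 1); last by ring.
exact/pi_adic_opp/(pi_adic_le _ (pi_adic_two 1)).
Qed.

(** [1 + (- 2 - x)] is the opposite of [1 + x], and [log (-1) = 0]. *)
Lemma logM_opp x : pi_adic 1 x -> logM (- 2 - x) = logM x.
Proof.
move=> Px; rewrite -[RHS]add0r -logM_neg1 -logM_mul //; first by congr logM; ring.
exact/pi_adic_opp/(pi_adic_le _ (pi_adic_two 1)).
Qed.

(** Write [x] as [2 * w].  If [pi] divides [w] then [x] is in [pi_adic 3];
otherwise [pi] divides [1 + w], and [- 2 - x], which has the same logarithm, is
in [pi_adic 3]. *)
Lemma logM_pi_adic2 x : pi_adic 2 x -> pi_adic 3 (logM x).
Proof.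
move=> P2x; have [w Ow dx] := (pi_adic_evenP 1 x).1 P2x.
have P3w v : pi_adic 1 v -> pi_adic 3 (2 * v) by move=> /(pi_adic_mul2 1).
have [Pw|Pw] := pi_adic_residue Ow.
  by apply: logM_pi_adic => //; rewrite dx; apply: P3w.
rewrite -logM_opp; last exact: pi_adic_le P2x.
apply: logM_pi_adic => //; rewrite (_ : _ - x = - (2 * (w - 1)) - 2 ^+ 2); last first.
  by rewrite dx; ring.
by apply: pi_adic_sub; [apply/pi_adic_opp/P3w | apply: pi_adic_le (pi_adic_two 2)].
Qed.

(** If [pi ^+ 2] does not divide [x], then [1 + x] is [1 + pi] times an element
of [1 + pi_adic 2].  The converse combines [logM_surj] with additivity. *)
Lemma logM_image y :
  (exists2 x, pi_adic 1 x & logM x = y) <-> pi_adic 3 y \/ pi_adic 3 (y - logM pi).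
Proof.
have Ppi : pi_adic 1 pi by exact: (pi_adic_pi 1).
have [u0 Ou] := one_plus_pi_unit Ppi.
split=> [[x Px <-]|[/logM_surj[x Px <-]|/logM_surj[z Pz e]]]; last first.
- exists ((1 + pi) * (1 + z) - 1); last first.
    by rewrite logM_mul ?e; [ring | | exact: pi_adic_le Pz].
  rewrite (_ : _ - 1 = pi + (1 + pi) * z); last by ring.
  apply: pi_adic_add => //; apply: pi_adic_intM; last exact: pi_adic_le Pz.
  by apply: intD; [apply: int1 | apply: int_pi].
- by exists x => //; apply: pi_adic_le Px.
have [w Ow dx] := Px.
have P2w v : pi_adic 1 v -> pi_adic 2 (pi * v) by move=> /(pi_adic_mulpi 1).
have [Pw|Pw] := pi_adic_residue Ow; [left | right].
  by apply: logM_pi_adic2; rewrite dx; apply: P2w.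
have Pz : pi_adic 2 ((x - pi) / (1 + pi)).
  rewrite mulrC; apply: pi_adic_intM => //.
  by rewrite dx (_ : _ - pi = pi * (w - 1)); [apply: P2w | ring].
have -> : x = (1 + pi) * (1 + (x - pi) / (1 + pi)) - 1 by field.
rewrite logM_mul //; last exact: pi_adic_le Pz.
by rewrite addrAC subrr add0r; apply: logM_pi_adic2.
Qed.

(** If [a] were odd, the combination would be a unit.  If [a] is even and [b]
odd, then [pi] would be divisible by 2.  So both coefficients can be halved,
indefinitely. *)
Lemma lattice_independent a b : Z2_to a + Z2_to b * pi = 0 -> a = 0 /\ b = 0.
Proof.
have half a' b' : Z2_to a' + Z2_to b' * pi = 0 ->
    exists a2 b2, [/\ a' = 2 * a2, b' = 2 * b2 & Z2_to a2 + Z2_to b2 * pi = 0].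
  move=> e.
  have [[a2 da]|odd_a] := Z2_parity a'; last first.
    have [/eqP] := lattice_unit_odd b' (introT (Z2_unit_oddP _) odd_a).
    by rewrite e.
  have [[b2 db]|odd_b] := Z2_parity b'; last first.
    have ub := introT (Z2_unit_oddP _) odd_b.
    case: pi_adic_one_notin; apply/(pi_adic_mulpi 1); rewrite expr1 mulr1.
    have b0 : Z2_to b' != 0 :> K.
      by rewrite Z2_to_eq0; apply: contraTneq ub => ->; rewrite unitr0.
    rewrite -[pi](mulKf b0) -Z2_to_unitV //; apply: pi_adic_intM; first exact: int_Z2.
    have -> : Z2_to b' * pi = - Z2_to a2 * 2.
      by apply/eqP; rewrite -subr_eq0 -e da; apply/eqP; ring.
    apply: pi_adic_intM; last exact: (pi_adic_two 1).
    by apply/intN/int_Z2.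
  exists a2, b2; split=> //; apply: (mulfI (two_neq0 K)).
  by rewrite mulr0 -e da db; ring.
move=> e.
have dvd n : exists a' b',
    [/\ a = 2 ^+ n * a', b = 2 ^+ n * b' & Z2_to a' + Z2_to b' * pi = 0].
  elim: n => [|n [a' [b' [-> -> /half[a2 [b2 [-> -> e2]]]]]]].
    by exists a, b; rewrite !mul1r.
  by exists a2, b2; rewrite !exprSr !mulrA.
by split; apply: Z2_separated => n; have [a' [b' [da db _]]] := dvd n;
  [exists a' | exists b'].
Qed.

Lemma pi_adic3_lattice y : pi_adic 3 y <-> exists a b, y = Z2_to a * (2 * pi) + Z2_to b * 4.
Proof.
split=> [[w /int_latticeP[a [b ->]] ->]|[a [b ->]]]; last first.
  apply: pi_adic_add; apply: pi_adic_intM; try exact: int_Z2.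
    by apply/(pi_adic_mul2 1)/(pi_adic_pi 1).
  by rewrite (_ : 4 = 2 ^+ 2); [apply: pi_adic_le (pi_adic_two 2) | ring].
exists ((s + 2 * t ^+ 2) * a + 4 * (s * t + t ^+ 3) * b),
  (s * t * a + s * (s + 2 * t ^+ 2) * b).
by ring: pi2.
Qed.

Lemma Z2_basis2P (e1 e2 : K) (M : set K) :
  (forall y, M y <-> exists a b, y = Z2_to a * e1 + Z2_to b * e2) ->
  (forall a b, Z2_to a * e1 + Z2_to b * e2 = 0 -> a = 0 /\ b = 0) ->
  is_Z2_basis [tuple e1; e2] M.
Proof.
move=> HM Hi; split; last first.
  move=> a; rewrite !big_ord_recl big_ord0 addr0 => /Hi[a0 a1].
  case=> -[|[|//]] lt_i; first by rewrite -a0; congr (a _); apply: val_inj.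
  by rewrite -a1; congr (a _); apply: val_inj.
apply/seteqP; split=> y /=.
  move=> /HM[a [b ->]]; exists (fun i => if i == ord0 then a else b).
  by rewrite !big_ord_recl big_ord0 addr0.
move=> [a ->]; apply/HM; exists (a ord0), (a (lift ord0 ord0)).
by rewrite !big_ord_recl big_ord0 addr0.
Qed.

(** * Bases of the image *)

Section Image.
Variable m : set K.
Hypothesis hm : isMaximalIdeal m.
Local Notation L := (@logM K @` m)%classic.

Lemma logM_image_m y : L y <-> pi_adic 3 y \/ pi_adic 3 (y - logM pi).
Proof.
rewrite -logM_image; have mP := maximal_idealP hm.
by split=> -[x /mP mx e]; exists x.
Qed.

(** Here the translate of [pi_adic 3] in [logM_image] is [pi_adic 3] itself. *)
Lemma basis_2pi_4 : pi_adic 3 (logM pi) -> is_Z2_basis [tuple 2 * pi; 4] L.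
Proof.
move=> Pl; apply: Z2_basis2P => [y|a b e].
  rewrite logM_image_m -pi_adic3_lattice; split=> [[//|Py]|]; last by left.
  by rewrite -[y](subrK (logM pi)); apply: pi_adic_add.
have [] := @lattice_independent (4 * b) (2 * a); first by rewrite -e; ring.
move=> /eqP + /eqP; rewrite !mulf_eq0.
by rewrite (negPf (Z2_nat_neq0 1)) (negPf (Z2_nat_neq0 3)) => /= /eqP -> /eqP ->.
Qed.

Lemma basis_2pi_2 : pi_adic 3 (logM pi - 2) -> is_Z2_basis [tuple 2 * pi; 2] L.
Proof.
move=> Pl; apply: Z2_basis2P => [y|a b e].
  rewrite logM_image_m; split=> [[/pi_adic3_lattice[a [b ->]]|Py]|[a [b ->]]].
  - by exists a, (2 * b); ring.
  - have /pi_adic3_lattice[a [b e]] : pi_adic 3 (y - 2).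
      by rewrite -[y](subrK (logM pi)) -addrA; apply: pi_adic_add.
    by exists a, (1 + 2 * b); rewrite -[y](subrK 2) e; ring.
  - have [[c ->]|[c ->]] := Z2_parity b; [left | right].
      by apply/pi_adic3_lattice; exists a, c; ring.
    rewrite (_ : _ - _ = (Z2_to a * (2 * pi) + Z2_to c * 4) - (logM pi - 2)); last by ring.
    by apply: pi_adic_sub => //; apply/pi_adic3_lattice; exists a, c.
have [] := @lattice_independent (2 * b) (2 * a); first by rewrite -e; ring.
move=> /eqP + /eqP; rewrite !mulf_eq0.
by rewrite (negPf (Z2_nat_neq0 1)) => /= /eqP -> /eqP ->.
Qed.

Lemma basis_pi_4 z : pi_adic 3 (logM pi - (pi + 2 * Z2_to z)) ->
  is_Z2_basis [tuple pi + 2 * Z2_to z; 4] L.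
Proof.
move=> Pl; apply: Z2_basis2P => [y|a b e].
  rewrite logM_image_m; split=> [[/pi_adic3_lattice[a [b ->]]|Py]|[a [b ->]]].
  - by exists (2 * a), (b - a * z); ring.
  - have /pi_adic3_lattice[a [b e]] : pi_adic 3 (y - (pi + 2 * Z2_to z)).
      by rewrite -[y](subrK (logM pi)) -addrA; apply: pi_adic_add.
    exists (1 + 2 * a), (b - a * z).
    by rewrite -[y](subrK (pi + 2 * Z2_to z)) e; ring.
  - have [[c ->]|[c ->]] := Z2_parity a; [left | right].
      by apply/pi_adic3_lattice; exists c, (b + c * z); ring.
    rewrite (_ : _ - _ = (Z2_to c * (2 * pi) + Z2_to (b + c * z) * 4)
      - (logM pi - (pi + 2 * Z2_to z))); last by ring.
    by apply: pi_adic_sub => //; apply/pi_adic3_lattice; exists c, (b + c * z).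
have [] := @lattice_independent (2 * z * a + 4 * b) a; first by rewrite -e; ring.
move=> + a0; rewrite a0 mulr0 add0r => /eqP; rewrite mulf_eq0.
by rewrite (negPf (Z2_nat_neq0 3)) => /= /eqP ->.
Qed.
End Image.

(** * Position of log (1 + pi) *)

Lemma logM_pi_root4 : (1 + pi) ^+ 4 = 1 -> pi_adic 3 (logM pi).
Proof.
move=> e; rewrite (@logM_torsion pi 2) //; first exact: pi_adic_zero.
exact: (pi_adic_pi 1).
Qed.

(** The squared element differs by a sign from [1 + x], where the logarithm is
under control. *)
Lemma logM_pi_double x : (1 + pi) ^+ 2 = - (1 + x) -> pi_adic 2 x -> 2 * logM pi = logM x.
Proof.
move=> e Px; have Ppi : pi_adic 1 pi by exact: (pi_adic_pi 1).
rewrite mulr_natl mulr2n -logM_mul // -(logM_opp (pi_adic_le _ Px)) //.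
by congr logM; rewrite -expr2 e; ring.
Qed.

Lemma pi_adic_halve k x : pi_adic k.+2 (2 * x) -> pi_adic k x.
Proof. by move=> /(pi_adic_mul2 1). Qed.

(** [3 = - (1 - 4)], so that [2 * logM pi] is the logarithm of [1 - 4], that
is, -4 modulo [pi_adic 5]. *)
Lemma logM_pi_sqrt3 : (1 + pi) ^+ 2 = 3 -> pi_adic 3 (logM pi - 2).
Proof.
move=> e.
have P4 : pi_adic 4 4 by rewrite (_ : 4 = 2 ^+ 2); [exact: (pi_adic_two 2) | ring].
have dl : 2 * logM pi = logM (- 4).
  by apply: logM_pi_double; [rewrite e; ring | apply: pi_adic_opp (pi_adic_le _ P4)].
have : pi_adic 5 (logM (- 4) - (- 4)) by apply: logM_approx => //; apply: pi_adic_opp.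
move=> h; apply: (@pi_adic_addr _ _ 4); first exact: pi_adic_le P4.
by apply: pi_adic_halve; rewrite (_ : 2 * _ = logM (- 4) - (- 4)) // -dl; ring.
Qed.

(** [(1 + pi) ^+ 2 = - (1 + x)] with [x = - (2 + pi ^+ 2) - 2 * pi], so
[2 * logM pi] is [- 2 * pi] modulo [pi_adic 4], and [logM pi] is [pi] modulo 2.
The error [2 * (z + v * pi)] reduces to [2 * z] modulo [pi_adic 3]. *)
Lemma logM_pi_even : pi_adic 4 (2 + pi ^+ 2) ->
  exists z, pi_adic 3 (logM pi - (pi + 2 * Z2_to z)).
Proof.
move=> P4; pose x := - (2 + pi ^+ 2) - 2 * pi.
have P2pi : pi_adic 3 (2 * pi) by apply/(pi_adic_mul2 1)/(pi_adic_pi 1).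
have Px : pi_adic 3 x by apply: pi_adic_sub => //; apply/pi_adic_opp/(pi_adic_le _ P4).
have dl : 2 * logM pi = logM x.
  by apply: logM_pi_double; [rewrite /x; ring | apply: pi_adic_le Px].
have Pl : pi_adic 2 (logM pi - pi).
  apply: (@pi_adic_addr _ _ (2 * pi)); first exact: pi_adic_le P2pi.
  apply: pi_adic_halve; rewrite (_ : 2 * _ = (logM x - x) - (2 + pi ^+ 2)).
    by apply: pi_adic_sub => //; apply: logM_approx.
  by rewrite -dl /x; ring.
have [w /int_latticeP[z [v ->]] e] := (pi_adic_evenP 1 _).1 Pl.
exists z; rewrite (_ : _ - _ = Z2_to v * (2 * pi)).
  by apply: pi_adic_intM => //; apply: int_Z2.
by rewrite opprD addrA e; ring.
Qed.

(** The first-order estimate of [logM_pi_even] leaves [z] undetermined; the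
second-order one gives [2 * logM pi = 6 * pi] modulo [pi_adic 6]. *)
Lemma logM_pi_sqrt2 : pi ^+ 2 = 2 -> pi_adic 3 (logM pi - pi).
Proof.
move=> e; pose x := - 4 - 2 * pi.
have P2pi : pi_adic 3 (2 * pi) by apply/(pi_adic_mul2 1)/(pi_adic_pi 1).
have P4 : pi_adic 4 4 by rewrite (_ : 4 = 2 ^+ 2); [exact: (pi_adic_two 2) | ring].
have P8 : pi_adic 6 8 by rewrite (_ : 8 = 2 ^+ 3); [exact: (pi_adic_two 3) | ring].
have Px : pi_adic 3 x by apply: pi_adic_sub => //; apply/pi_adic_opp/(pi_adic_le _ P4).
have dl : 2 * logM pi = logM x.
  by apply: logM_pi_double; [rewrite /x; ring: e | apply: pi_adic_le Px].
apply: (@pi_adic_addr _ _ (- (2 * pi))); first exact: pi_adic_opp.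
apply: (@pi_adic_le _ 4) => //; apply: pi_adic_halve.
rewrite (_ : 2 * _ = (logM x - (x + x ^+ 2 / 2)) + 8).
  by apply: pi_adic_add => //; apply: (@logM_approx2 3).
have -> : x ^+ 2 / 2 = 12 + 8 * pi.
  by apply: (mulIf (two_neq0 K)); rewrite divfK ?two_neq0 // /x; ring: e.
by rewrite -dl /x; ring.
Qed.

End Eisenstein.

(** * Quadratic extensions of Q2 *)

(** Every power of [r] is reduced to degree at most 1 by [r ^+ 2 = d]. *)
Lemma quadratic_generated (K : fieldExtType Q2) (r : K) (d : int) :
  r ^+ 2 = d%:~R -> <<1; r>>%VS = {:K}%VS ->
  forall x : K, exists A B : Q2, x = A%:A + B%:A * r.
Proof.
move=> hr hK x.
have rpow i : exists A B : Q2, r ^+ i = A%:A + B%:A * r.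
  elim: i => [|i [A [B e]]]; first by exists 1, 0; rewrite scale1r scale0r mul0r addr0.
  exists (B * d%:~R), A; rewrite exprSr e mulrDl -mulrA -expr2 hr addrC.
  by congr (_ + _); rewrite -scalerA scaler_int -scalerAl mul1r.
have /Fadjoin_polyP[p /polyOver1P[q ->] ->] : x \in <<1; r>>%VS by rewrite hK memvf.
rewrite horner_coef; elim/big_ind: _ => [|y z [A [B ->]] [A' [B' ->]]|i _].
- by exists 0, 0; rewrite !scale0r mul0r addr0.
- by exists (A + A'), (B + B'); rewrite !scalerDl mulrDl addrACA.
have [A [B ->]] := rpow i.
rewrite coef_map /=; exists (q`_i * A), (q`_i * B).
by rewrite mulrDr mulrA -!scalerA -!scalerAl !mul1r -!scalerAl mul1r.
Qed.

Theorem theorem2p13 (d : int) (hd : d \in [:: -1; 2; -2; 3; 6; -6])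
    (K : fieldExtType Q2) (r : K)
    (hr : r ^+ 2 = d%:~R) (hK : <<1; r>>%VS = {:K}%VS)
    (m : set K) (hm : isMaximalIdeal m) :
  let pi : K := if (2 %| d)%Z then r else -1 + r in
  let L : set K := (@logM K @` m)%classic in
  (d = -1 -> is_Z2_basis [tuple 2 * pi; 4] L) /\
  (d = -2 -> exists u z : Z2, u \is a GRing.unit /\
     is_Z2_basis [tuple Z2_to u * pi + 2 * Z2_to z; 4] L) /\
  (d = 2 -> is_Z2_basis [tuple pi; 4] L) /\
  (d = 3 -> is_Z2_basis [tuple 2 * pi; 2] L) /\
  (d = -6 -> exists z : Z2, is_Z2_basis [tuple pi + 2 * Z2_to z; 4] L) /\
  (d = 6 -> exists z : Z2, is_Z2_basis [tuple pi + 2 * Z2_to z; 4] L).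
Proof.
have gen := quadratic_generated hr hK.
have gen1 (x : K) : exists A B : Q2, x = A%:A + B%:A * (-1 + r).
  have [A [B ->]] := gen x; exists (A + B), B; rewrite scalerDl; ring.
have odd_unit (c : Z2) k : c = 1 + 2 * k -> c \is a GRing.unit.
  by move=> e; apply/Z2_unit_oddP; exists k.
have even_basis (c k : int) : d = 2 * c -> c = 1 + 2 * k ->
    exists z, is_Z2_basis [tuple r + 2 * Z2_to z; 4] (@logM K @` m)%classic.
  move=> dc ck; have uc : (c%:~R : Z2) \is a GRing.unit.
    by apply: (odd_unit _ k%:~R); rewrite ck; ring.
  have r2 : r ^+ 2 = 2 * (Z2_to c%:~R + Z2_to 0 * r) by rewrite hr dc; ring.
  have [|z Pz] := logM_pi_even uc r2 gen; last first.
    by exists z; apply: (basis_pi_4 uc r2 gen hm).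
  rewrite r2 ck (_ : _ + _ = Z2_to (1 + k%:~R) * 2 ^+ 2); last by ring.
  apply: pi_adic_intM; first exact: int_Z2.
  exact: (pi_adic_two uc r2 gen 2).
split; [|split; [|split; [|split; [|split]]]] => dE; subst d; rewrite /=.
- have u1 : (-1 : Z2) \is a GRing.unit by apply: (odd_unit _ (-1)); ring.
  have p2 : (-1 + r) ^+ 2 = 2 * (Z2_to (-1) + Z2_to (-1) * (-1 + r)) by ring: hr.
  apply: (basis_2pi_4 u1 p2 gen1 hm); apply: (logM_pi_root4 u1 p2 gen1).
  by rewrite addrA subrr add0r; ring: hr.
- have [|//|z hz] := even_basis (-1) (-1); first by [].
  by exists 1, z; split; [exact: unitr1 | rewrite rmorph1 mul1r].
- have r2 : r ^+ 2 = 2 * (Z2_to 1 + Z2_to 0 * r) by rewrite hr; ring.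
  have := @basis_pi_4 _ _ _ _ (unitr1 _) r2 gen m hm 0.
  rewrite rmorph0 mulr0 addr0; apply; apply: (logM_pi_sqrt2 (unitr1 _) r2 gen).
  by rewrite hr.
- have p2 : (-1 + r) ^+ 2 = 2 * (Z2_to 1 + Z2_to (-1) * (-1 + r)) by ring: hr.
  apply: (basis_2pi_2 (unitr1 _) p2 gen1 hm); apply: (logM_pi_sqrt3 (unitr1 _) p2 gen1).
  by rewrite addrA subrr add0r hr.
- by apply: (even_basis (-3) (-2)).
- by apply: (even_basis 3 1).
Qed.
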